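(* Let $G$ be a graph with minimum degree $\delta > 0$ and maximum degree $\Delta$. Then $$GA_1(G) \geq \Delta(\delta + 1) \frac{\sqrt{\delta\Delta}}{\delta + \Delta},$$ with equality if and only if either $\delta = 1$ and $G$ is a star graph, or $\delta = \Delta$ and $G$ is a complete graph. Furthermore, if $\Delta(\delta + 1)$ is odd, then $$GA_1(G) \geq (\Delta(\delta + 1) + 1) \frac{\sqrt{\delta\Delta}}{\delta + \Delta}.$$
   Context: All graphs are finite, simple (no loops or multiple edges) and have at least one edge. For a vertex $u$, $d_u$ denotes its degree. The (first) geometric-arithmetic index of $G$ is $GA_1(G) = \sum_{uv \in E(G)} \frac{2\sqrt{d_u d_v}}{d_u + d_v}$, the sum over all edges $uv$ of $G$. *)

(* Defs.v *)
From HB Require Import structures.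
From mathcomp Require Import all_boot all_order all_algebra.

Set Implicit Arguments.
Unset Strict Implicit.
Unset Printing Implicit Defensive.

Import Order.TTheory GRing.Theory Num.Theory.

Record sgraph := SGraph {
  vertex :> finType;
  adj : rel vertex;
  adj_sym : symmetric adj;
  adj_irr : irreflexive adj
}.

Definition edges (G : sgraph) : {set {set G}} :=
  [set e : {set G} | [exists u, exists v, adj u v && (e == [set u; v])]].

Definition deg (G : sgraph) (u : G) : nat := #|[set v | adj u v]|.

Definition is_min_degree (G : sgraph) (delta : nat) : Prop :=
  (exists u : G, deg u = delta) /\ (forall u : G, delta <= deg u).

Definition is_max_degree (G : sgraph) (Delta : nat) : Prop :=
  (exists u : G, deg u = Delta) /\ (forall u : G, deg u <= Delta).

Definition is_star (G : sgraph) : Prop :=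
  exists c : G, forall u v : G, adj u v = (u != v) && ((u == c) || (v == c)).

Definition is_complete (G : sgraph) : Prop :=
  forall u v : G, adj u v = (u != v).

Local Open Scope ring_scope.

(* An edge is the two-element set e = {u, v}, so the product and the sum over *)
(* its elements are d_u d_v and d_u + d_v, as ga_term_edge confirms.          *)
Definition ga_term (R : rcfType) (G : sgraph) (e : {set G}) : R :=
  2 * Num.sqrt (\prod_(u in e) (deg u)%:R) / (\sum_(u in e) (deg u)%:R).

Definition GA1 (R : rcfType) (G : sgraph) : R :=
  \sum_(e in edges G) ga_term R e.

Lemma ga_term_edge (R : rcfType) (G : sgraph) (u v : G) : adj u v ->
  ga_term R [set u; v] =
    2 * Num.sqrt ((deg u)%:R * (deg v)%:R) / ((deg u)%:R + (deg v)%:R).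
Proof.
move=> uv; have nuv : u != v by apply: contraTneq uv => ->; rewrite adj_irr.
by rewrite /ga_term !big_setU1 ?inE //= !big_set1.
Qed.

(* Main.v *)
Require Import Defs.
From mathcomp Require Import all_boot all_order all_algebra.
From mathcomp Require Import ring.

Import Order.TTheory GRing.Theory Num.Theory.
Local Open Scope ring_scope.

(** Every edge contributes at least [2 * ratio], because
    [a b (c + d)^2 - c d (a + b)^2 = (a d - b c) (b d - a c)] is nonnegative
    when [a] and [b] lie between [c] and [d]; hence [GA1 G >= 2 m * ratio]
    with [m] the number of edges. By the handshake lemma [2 m] is the sum of
    the degrees; a vertex [w] of degree [Delta] together with at least [Delta]
    other vertices of degree at least [delta] makes it at least
    [Delta (delta + 1)], and [2 m] is even. In the equality case [w] is
    adjacent to all other vertices and those have degree [delta]; if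
    [1 < delta < Delta] two of them are adjacent, and the edge joining them
    contributes [1 > 2 * ratio]. *)

(** * Comparing geometric-arithmetic ratios of positive numbers *)

Section GARatio.

Variable R : rcfType.
Implicit Types a b c d : R.

Definition ga_ratio a b : R := Num.sqrt (a * b) / (a + b).

Lemma ga_ratioC a b : ga_ratio a b = ga_ratio b a.
Proof. by rewrite /ga_ratio (mulrC a) (addrC a). Qed.

Lemma ga_ratio_gt0 a b : 0 < a -> 0 < b -> 0 < ga_ratio a b.
Proof.
by move=> a0 b0; rewrite divr_gt0 ?sqrtr_gt0 ?mulr_gt0 ?addr_gt0.
Qed.

(** Both ratios are nonnegative, so squaring and clearing denominators reduces the comparison to the
    sign of a difference that factors. *)
Lemma le_ga_ratio a b c d : 0 < a -> 0 < b -> 0 < c -> 0 < d ->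
  (ga_ratio c d <= ga_ratio a b) = (0 <= (a * d - b * c) * (b * d - a * c)).
Proof.
move=> a0 b0 c0 d0.
have ratio_ge0 (x y : R) : 0 < x -> 0 < y -> 0 <= ga_ratio x y.
  by move=> x0 y0; apply/ltW/ga_ratio_gt0.
rewrite -ler_sqr ?nnegrE ?ratio_ge0 // /ga_ratio !expr_div_n.
rewrite (sqr_sqrtr (ltW (mulr_gt0 a0 b0))) (sqr_sqrtr (ltW (mulr_gt0 c0 d0))).
rewrite ler_pdivrMr ?exprn_gt0 ?addr_gt0 // mulrAC.
rewrite ler_pdivlMr ?exprn_gt0 ?addr_gt0 // -subr_ge0.
by congr (0 <= _); ring.
Qed.

Lemma ga_ratio_minimal a b c d : 0 < c ->
  c <= a <= d -> c <= b <= d -> ga_ratio c d <= ga_ratio a b.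
Proof.
move=> c0 /andP[ca ad] /andP[cb bd].
have [a0 b0] : 0 < a /\ 0 < b by split; [apply: lt_le_trans ca|apply: lt_le_trans cb].
rewrite le_ga_ratio ?(lt_le_trans a0 ad) // mulr_ge0 // subr_ge0.
  by rewrite (mulrC b); apply: ler_pM => //; apply: ltW.
by rewrite (mulrC a); apply: ler_pM => //; apply: ltW.
Qed.

Lemma ga_ratio_diag_inj c d : 0 < c -> 0 < d ->
  ga_ratio c c = ga_ratio c d -> c = d.
Proof.
move=> c0 d0 eq_cd; have: ga_ratio c c <= ga_ratio c d by rewrite eq_cd.
rewrite le_ga_ratio //.
(* On the diagonal the product is minus a square, hence nonnegative only when it vanishes. *)
have -> : (c * c - d * c) * (d * c - c * c) = - (c * (c - d)) ^+ 2 by ring.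
rewrite oppr_ge0 => sq_le0; have /eqP : (c * (c - d)) ^+ 2 = 0.
  by apply: le_anti; rewrite sq_le0 sqr_ge0.
by rewrite sqrf_eq0 mulf_eq0 (gt_eqF c0) subr_eq0 => /eqP.
Qed.

End GARatio.

(** * Counting edges by degrees *)

Section Degrees.

Variable G : sgraph.
Implicit Types (u v w : G) (e : {set G}).

Lemma edgesP e :
  reflect (exists u v, adj u v /\ e = [set u; v]) (e \in edges G).
Proof.
rewrite inE; apply: (iffP existsP) => [[u /existsP[v /andP[uv /eqP->]]]|].
  by exists u, v.
by move=> [u [v [uv ->]]]; exists u; apply/existsP; exists v; rewrite uv eqxx.
Qed.

Lemma adj_neq u v : adj u v -> u != v.
Proof. by apply: contraTneq => ->; rewrite adj_irr. Qed.

(** Sending a neighbour [v] to [[set u; v]] is a bijection onto the edges through [u]. This prepares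
    the double counting in [handshake]. *)
Lemma deg_incident u : deg u = #|[set e in edges G | u \in e]|.
Proof.
have inj_u : {in [set v | adj u v] &, injective (fun v => [set u; v])}.
  move=> v v'; rewrite !inE => uv _ /setP/(_ v).
  rewrite !inE eqxx orbT => /esym /orP[/eqP vu|/eqP//].
  by rewrite vu adj_irr in uv.
rewrite /deg -(card_in_imset inj_u); apply: eq_card => e; rewrite [RHS]inE.
apply/imsetP/andP => [[v] | [/edgesP[x [y [xy ->]]]]].
  rewrite inE => uv ->; rewrite set21; split=> //.
  by apply/edgesP; exists u, v.
rewrite !inE => /orP[] /eqP->; first by exists y; rewrite ?inE.
by exists x; rewrite ?inE 1?adj_sym // setUC.
Qed.

Lemma handshake : (\sum_(u : G) deg u = 2 * #|edges G|)%N.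
Proof.
under eq_bigr => u _ do rewrite deg_incident -sum1dep_card big_mkcondr.
rewrite exchange_big mulnC -sum_nat_const /=.
apply: eq_bigr => e /edgesP[u [v [uv ->]]].
by rewrite -big_mkcond /= sum1_card cards2 adj_neq.
Qed.

Lemma leq_deg_card u : (deg u <= #|G|.-1)%N.
Proof.
rewrite -(cardC1 u); apply/subset_leq_card/subsetP => v.
by rewrite !inE => /adj_neq; rewrite eq_sym.
Qed.

Lemma deg_full w : deg w = #|G|.-1 -> forall v, adj w v = (w != v).
Proof.
move=> degw v; have : [set v | adj w v] == [set~ w].
  rewrite eqEcard -[X in (_ <= X)%N]/(deg w) degw cardsC1 leqnn andbT.
  by apply/subsetP => x; rewrite !inE => /adj_neq; rewrite eq_sym.
by move=> /eqP/setP/(_ v); rewrite !inE eq_sym.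
Qed.

Variables (delta Delta : nat).
Hypotheses (min_delta : is_min_degree G delta)
  (max_Delta : is_max_degree G Delta) (delta_gt0 : (0 < delta)%N).

(** After [w] is set aside, two estimates are chained: there are at least [Delta] other vertices,
    and each has degree at least [delta]. The [leqif] form keeps track of when both are tight. *)
Lemma sum_deg_leqif w : deg w = Delta ->
  (Delta * (delta + 1) <= \sum_(u : G) deg u ?= iff
     (Delta == #|G|.-1) && [forall (u : G | u != w), delta == deg u])%N.
Proof.
move=> degw; have [_ le_delta] := min_delta.
have := leqif_sum (fun u (_ : u != w) => leqif_eq (le_delta u)).
rewrite sum_nat_const cardC1 => le2.
have le1 : (Delta * delta <= #|G|.-1 * delta ?= iff (Delta == #|G|.-1))%N.
  split; first by rewrite leq_mul2r -degw leq_deg_card orbT.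
  (* Cancelling [delta] requires it to be positive. *)
  by rewrite eqn_pmul2r.
have [le3 eq3] := leqif_trans le1 le2.
by rewrite (bigD1 w) //= degw mulnDr muln1 addnC; split; rewrite ?leq_add2l ?eqn_add2l.
Qed.

Lemma leq_sum_deg : (Delta * (delta + 1) <= \sum_(u : G) deg u)%N.
Proof. by have [[w degw] _] := max_Delta; apply: (sum_deg_leqif w degw). Qed.

Lemma star_sum_deg c : delta = 1%N ->
  (forall u v, adj u v = (u != v) && ((u == c) || (v == c))) ->
  [/\ deg c = Delta, forall u, u != c -> deg u = 1%N
    & \sum_(u : G) deg u = (Delta * (delta + 1))%N].
Proof.
move=> delta1 star; have deg1 u : u != c -> deg u = 1%N.
  move=> uc; rewrite /deg -(cards1 c); apply: eq_card => v.
  rewrite !inE star (negPf uc) /=; have [->|] := eqVneq v c; first by rewrite uc.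
  by rewrite andbF.
have degcG : deg c = #|G|.-1.
  rewrite -(cardC1 c); apply: eq_card => v.
  by rewrite !inE star eqxx andbT eq_sym.
have degc : deg c = Delta.
  have [[w degw] le_Delta] := max_Delta; apply/eqP; rewrite eqn_leq le_Delta /=.
  have [<-|wc] := eqVneq w c; first by rewrite degw.
  (* If the maximum is attained off the centre, then [Delta] is 1, which is [delta], a lower bound
     for [deg c]. *)
  by rewrite -degw deg1 // -delta1; case: min_delta.
split=> //; apply/esym/eqP; rewrite (sum_deg_leqif c degc) -degc degcG eqxx /=.
by apply/forall_inP => u uc; rewrite deg1 // delta1.
Qed.

Lemma complete_sum_deg : delta = Delta -> is_complete G ->
  \sum_(u : G) deg u = (Delta * (delta + 1))%N.
Proof.
move=> eq_dD complete; have [[w degw] le_Delta] := max_Delta.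
have [_ le_delta] := min_delta.
apply/esym/eqP; rewrite (sum_deg_leqif w degw); apply/andP; split.
  rewrite -degw -(cardC1 w); apply/eqP/eq_card => v.
  by rewrite !inE complete eq_sym.
by apply/forall_inP => u _; rewrite eqn_leq le_delta eq_dD le_Delta.
Qed.

(** The second hypothesis is the only consequence of tight edge terms that is needed, phrased
    without real numbers. *)
Lemma extremal_star_or_complete : \sum_(u : G) deg u = (Delta * (delta + 1))%N ->
  (forall u v, adj u v -> deg u = delta -> deg v = delta -> delta = Delta) ->
  (delta = 1%N /\ is_star G) \/ (delta = Delta /\ is_complete G).
Proof.
move=> sum_eq low_edge; have [[w degw] le_Delta] := max_Delta.
have := (sum_deg_leqif w degw).2; rewrite sum_eq eqxx => /esym/andP[].
move=> /eqP cardG /forall_inP deg_delta.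
have degE u : u != w -> deg u = delta by move=> /deg_delta/eqP.
have adjw := deg_full w (etrans degw cardG).
have [dD|ndD] := eqVneq delta Delta.
  right; split=> // u; apply: deg_full; rewrite -cardG.
  by have [->|/degE->] := eqVneq u w.
have star u v : adj u v = (u != v) && ((u == w) || (v == w)).
  have [->|uw] /= := eqVneq u w; first by rewrite adjw andbT.
  have [->|vw] := eqVneq v w; first by rewrite adj_sym adjw eq_sym andbT.
  rewrite andbF; apply/negP => uv; case/eqP: ndD.
  by apply: (low_edge u v) => //; apply: degE.
left; split; last by exists w.
(* A leaf [u] of the star has degree 1 and also degree [delta]. *)
have [u uw] : exists u, u != w.
  have /card_gt0P[u] : (0 < deg w)%N.
    by apply: leq_trans delta_gt0 _; case: min_delta.
  by rewrite inE adjw eq_sym => uw; exists u.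
rewrite -(degE u uw) /deg -(cards1 w); apply: eq_card => v.
rewrite !inE star (negPf uw) /=; have [->|] := eqVneq v w; first by rewrite uw.
by rewrite andbF.
Qed.

End Degrees.

(** * The bound on the index and its equality case *)

Section GABound.

Variables (R : rcfType) (G : sgraph) (delta Delta : nat).
Hypotheses (min_delta : is_min_degree G delta)
  (max_Delta : is_max_degree G Delta) (delta_gt0 : (0 < delta)%N).

Let ratio : R := ga_ratio R delta%:R Delta%:R.

Lemma ga_term_ratio (u v : G) : adj u v ->
  ga_term R [set u; v] = 2 * ga_ratio R (deg u)%:R (deg v)%:R.
Proof. by move=> uv; rewrite ga_term_edge // /ga_ratio mulrA. Qed.

Lemma max_degree_gt0 : (0 < Delta)%N.
Proof.
have [[w <-] _] := max_Delta; apply: leq_trans delta_gt0 _.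
by case: min_delta.
Qed.

Lemma ratio_gt0 : 0 < ratio.
Proof. by rewrite ga_ratio_gt0 // ltr0n // max_degree_gt0. Qed.

Lemma ga_term_ge (e : {set G}) : e \in edges G -> 2 * ratio <= ga_term R e.
Proof.
have [_ le_delta] := min_delta; have [_ le_Delta] := max_Delta.
move=> /edgesP[u [v [uv ->]]]; rewrite ga_term_ratio // ler_pM2l //.
by apply: ga_ratio_minimal; rewrite ?ltr0n // !ler_nat le_delta le_Delta.
Qed.

Lemma sum_deg_ratio :
  (\sum_(u : G) deg u)%N%:R * ratio = \sum_(e in edges G) 2 * ratio.
Proof. by rewrite handshake sumr_const -mulr_natl natrM; ring. Qed.

Lemma GA1_ge : (\sum_(u : G) deg u)%N%:R * ratio <= GA1 R G.
Proof. by rewrite sum_deg_ratio; apply: ler_sum => e; apply: ga_term_ge. Qed.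

(** The bound passes through the degree sum times [ratio], so equality means that both the degree
    count and the edgewise estimate are tight. *)
Lemma GA1_eq_extremal : GA1 R G = (Delta * (delta + 1))%:R * ratio <->
  \sum_(u : G) deg u = (Delta * (delta + 1))%N /\
  (forall e, e \in edges G -> ga_term R e = 2 * ratio).
Proof.
split=> [GAeq | [<- terms]]; last first.
  by rewrite sum_deg_ratio; apply: eq_bigr.
have sum_eq : \sum_(u : G) deg u = (Delta * (delta + 1))%N.
  apply/eqP; rewrite eqn_leq leq_sum_deg // andbT.
  by have := GA1_ge; rewrite GAeq ler_pM2r ?ratio_gt0 // ler_nat.
split=> // e eG; apply/eqP; rewrite -subr_eq0; apply/eqP; move: e eG.
(* The excesses of the edge terms over [2 * ratio] are nonnegative and sum to zero. *)
apply: psumr_eq0P => [e /ga_term_ge|]; first by rewrite subr_ge0.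
by rewrite sumrB -sum_deg_ratio sum_eq -GAeq subrr.
Qed.

Lemma GA1_eq_iff : GA1 R G = (Delta * (delta + 1))%:R * ratio <->
  (delta = 1%N /\ is_star G) \/ (delta = Delta /\ is_complete G).
Proof.
rewrite GA1_eq_extremal; split=> [[sum_eq terms] | ].
  apply: extremal_star_or_complete => // u v uv du dv.
  have: ga_term R [set u; v] = 2 * ratio.
    by apply: terms; apply/edgesP; exists u, v.
  rewrite ga_term_ratio // du dv => /mulfI; rewrite pnatr_eq0 => /(_ isT).
  move=> /ga_ratio_diag_inj; rewrite !ltr0n max_degree_gt0 delta_gt0.
  by move=> /(_ isT isT)/eqP; rewrite eqr_nat => /eqP.
case=> [[delta1 [c star]] | [dD complete]].
  have [degc deg1 sum_eq] :=
    star_sum_deg G delta Delta min_delta max_Delta delta_gt0 c delta1 star.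
  split=> // e /edgesP[u [v [uv ->]]]; rewrite ga_term_ratio //; congr (_ * _).
  have := uv; rewrite star => /andP[nuv /orP[] /eqP Ec]; rewrite Ec in nuv *.
    by rewrite degc deg1 1?eq_sym // ga_ratioC /ratio delta1.
  by rewrite degc deg1 // /ratio delta1.
split; first exact: complete_sum_deg.
have [_ le_delta] := min_delta; have [_ le_Delta] := max_Delta.
have degE (u : G) : deg u = Delta.
  by apply/eqP; rewrite eqn_leq le_Delta -dD le_delta.
move=> e /edgesP[u [v [uv ->]]].
by rewrite ga_term_ratio // !degE /ratio dD.
Qed.

End GABound.

Theorem theorem2p7 (R : rcfType) (G : sgraph) (delta Delta : nat)
  (edgesG : edges G != set0)
  (min_delta : is_min_degree G delta) (max_Delta : is_max_degree G Delta)
  (delta_gt0 : (0 < delta)%N) :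
  let ratio : R := Num.sqrt (delta%:R * Delta%:R) / (delta%:R + Delta%:R) in
  [/\ GA1 R G >= (Delta * (delta + 1))%:R * ratio,
      GA1 R G = (Delta * (delta + 1))%:R * ratio <->
        (delta = 1%N /\ is_star G) \/ (delta = Delta /\ is_complete G)
    & odd (Delta * (delta + 1)) ->
        GA1 R G >= (Delta * (delta + 1) + 1)%:R * ratio].
Proof.
move=> ratio; have r0 : 0 < ratio by apply: (ratio_gt0 R G).
have sum_le := leq_sum_deg G delta Delta min_delta max_Delta delta_gt0.
have GA_ge k : (k <= \sum_(u : G) deg u)%N -> k%:R * ratio <= GA1 R G.
  move=> le_k; apply: le_trans (GA1_ge R G delta Delta _ _ _) => //.
  by rewrite ler_pM2r // ler_nat.
split; [exact: GA_ge | exact: GA1_eq_iff | move=> odd_k; apply: GA_ge].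
(* The degree sum is even, so it cannot equal the odd lower bound and exceeds it by at least one. *)
rewrite addn1 ltn_neqAle sum_le andbT; apply: contraTneq odd_k => ->.
by rewrite handshake oddM.
Qed.
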